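(* Let $G=(V,E)$ be a finite graph with $E\neq\emptyset$, let $\mathcal{S}=\{S_i\}_{i\in V}$ be a scale on $G$ that contains at least one nonempty set, and let $\overline{\mathcal{S}}=\{\overline{S}_i\}_{i\in V}$ be its dual scale. The optimal value of the uniform pseudo-flow problem (U) at scale $\overline{\mathcal{S}}$ is equal to $$\frac{|V|}{|E|}\,\gamma(G,\overline{\mathcal{S}}),$$ where $\gamma(G,\overline{\mathcal{S}})$ is the Cheeger constant of $G$ at scale $\overline{\mathcal{S}}$.
   Context: A graph $G=(V,E)$ is oriented, with $E\subset V\times V$ and no self-loops; $ij\in E$ denotes an edge with initial vertex $i$ and terminal vertex $j$. A scale on $G$ is a family $\mathcal{S}=\{S_i\}_{i\in V}$ of subsets of $V$; its dual scale is $\overline{\mathcal{S}}=\{\overline{S}_i\}_{i\in V}$ with $\overline{S}_i=\{j\in V: i\in S_j\}$. For $T\subset V$ the edge boundary is $\partial T=\big((T\times(V\setminus T))\cup((V\setminus T)\times T)\big)\cap E$. The Cheeger constant of $G$ at a scale $\mathcal{U}$ is $$\gamma(G,\mathcal{U})=\min\left\{\frac{|\partial T|}{|T|}: T\neq\emptyset,\ T\subset U\text{ for some }U\in\mathcal{U}\right\}.$$ (U): maximize $|V|\cdot\eta$ subject to - $-\frac{1}{|E|}\le\varphi_{ij,k}\le\frac{1}{|E|}$ for each $ij\in E$, $k\in V$; - $\sum_{j\in V,\,ji\in E}\varphi_{ji,k}-\sum_{j\in V,\,ij\in E}\varphi_{ij,k}\ge\eta$ for each $k\in V$, $i\in\overline{S}_k$;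 - $\eta,\varphi_{ij,k}\in\mathbb{R}$. *)

(* Defs.v *)
From HB Require Import structures.
From mathcomp Require Import all_boot all_order all_algebra.
From mathcomp Require Import reals.

Set Implicit Arguments.
Unset Strict Implicit.
Unset Printing Implicit Defensive.

Import Order.TTheory GRing.Theory Num.Theory.
Local Open Scope ring_scope.

(* An oriented graph on a finite vertex type V is its edge set
   E : {set V * V}, where (i, j) \in E is the edge ij from i to j. *)

Definition no_self_loops (V : finType) (E : {set V * V}) : Prop :=
  forall i : V, (i, i) \notin E.

Definition scale (V : finType) : Type := V -> {set V}.

Definition dual_scale (V : finType) (S : scale V) : scale V :=
  fun i => [set j | i \in S j].

Definition edge_boundary (V : finType) (E : {set V * V}) (T : {set V}) :
    {set V * V} :=
  (setX T (~: T) :|: setX (~: T) T) :&: E.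

Definition cheeger_ratio (R : realType) (V : finType) (E : {set V * V})
    (T : {set V}) : R :=
  #|edge_boundary E T|%:R / #|T|%:R.

Definition cheeger_admissible (V : finType) (U : scale V) (T : {set V}) : bool :=
  (T != set0) && [exists i, T \subset U i].

(* The pick only supplies the starting point required by [arg min ...]; the
   minimal value does not depend on it. The default 0 is returned only if every
   set of the scale is empty, when there is nothing to minimize over. *)
Definition cheeger (R : realType) (V : finType) (E : {set V * V})
    (U : scale V) : R :=
  if [pick T | cheeger_admissible U T] is Some T0 then
    cheeger_ratio R E
      [arg min_(T < T0 | cheeger_admissible U T) cheeger_ratio R E T]%O
  else 0.

(* phi (i, j) k is the variable phi_{ij,k}; the values of phi at pairs outside E
   occur neither in the constraints nor in the objective. *)
Definition uniform_feasible (R : realType) (V : finType) (E : {set V * V})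
    (U : scale V) (eta : R) (phi : V * V -> V -> R) : Prop :=
  (forall (e : V * V) (k : V), e \in E ->
     - (1 / #|E|%:R) <= phi e k <= 1 / #|E|%:R) /\
  (forall k i : V, i \in U k ->
     \sum_(j | (j, i) \in E) phi (j, i) k
       - \sum_(j | (i, j) \in E) phi (i, j) k >= eta).

Definition uniform_optimal_value (R : realType) (V : finType) (E : {set V * V})
    (U : scale V) (v : R) : Prop :=
  (exists eta phi, uniform_feasible E U eta phi /\ #|V|%:R * eta = v) /\
  (forall eta phi, uniform_feasible E U eta phi -> #|V|%:R * eta <= v).

(* Main.v *)
Require Import Defs.
From mathcomp Require Import all_boot all_order all_algebra.
From mathcomp Require Import reals lra.

Set Implicit Arguments.
Unset Strict Implicit.
Unset Printing Implicit Defensive.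

Import Order.TTheory GRing.Theory Num.Theory.
Local Open Scope ring_scope.

(** The variables [phi_{ij,k}] with different [k] interact only through [eta],
    so the problem amounts to asking, for each set [U] of the scale, which
    excess [eta] a flow bounded by [1/|E|] can deliver at every vertex of [U].

    No feasible [eta] is too large: summing the excesses over [T] contained in
    [U], edges inside or outside [T] cancel and an edge of the boundary
    contributes at most [1/|E|], so [eta |T| <= |boundary of T| / |E|]
    ([sum_excess_le_cut]). A set [T] realizing the Cheeger constant gives the
    upper bound.

    Conversely, these cut inequalities are sufficient for a flow to exist
    ([cut_condition_flow]), a form of the max-flow min-cut theorem. The proof
    removes one edge [e] at a time, putting on it a flow [x] that keeps all the
    cut inequalities valid on the remaining graph with the demands updated at
    the two endpoints. A set entered by [e] bounds [x] from below, a set left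
    by [e] bounds it from above, and a lower bound never exceeds an upper bound
    because the cut function is submodular ([cut_submod]) while [e] crosses
    neither the intersection nor the union of two such sets. *)

(** * Cuts and excesses *)

Section Cuts.
Variables (R : realDomainType) (V : finType).
Implicit Types (e : V * V) (F : {set V * V}) (T W : {set V}).
Implicit Types (u phi : V * V -> R) (b : V -> R).

Definition crosses e T : bool := (e.1 \in T) != (e.2 \in T).

(** The coboundary of the indicator of [T]: [1] if [e] enters [T], [-1] if it
    leaves [T], and [0] otherwise. *)
Definition entry e T : R := (e.2 \in T)%:R - (e.1 \in T)%:R.

Definition cut u F T : R := \sum_(e in F | crosses e T) u e.

Definition excess phi F i : R := \sum_(e in F) phi e * entry e [set i].

Lemma sum_eq_mem T (v : V) : \sum_(i in T) (v == i)%:R = (v \in T)%:R :> R.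
Proof.
case: (boolP (v \in T)) => vT.
  rewrite (bigD1 v) //= eqxx big1 ?addr0 // => i /andP[_ iv].
  by rewrite eq_sym (negbTE iv).
by rewrite big1 // => i iT; case: eqP => // vi; rewrite vi iT in vT.
Qed.

Lemma sum_entry e T : \sum_(i in T) entry e [set i] = entry e T.
Proof.
under eq_bigr do rewrite /entry !inE.
by rewrite sumrB !sum_eq_mem.
Qed.

Lemma sum_excess phi F T :
  \sum_(i in T) excess phi F i = \sum_(e in F) phi e * entry e T.
Proof.
by rewrite exchange_big /=; apply: eq_bigr => e _; rewrite -mulr_sumr sum_entry.
Qed.

Lemma excessE phi F i :
  excess phi F i = \sum_(j | (j, i) \in F) phi (j, i)
                   - \sum_(j | (i, j) \in F) phi (i, j).
Proof.
have reidx (h : V -> V * V) (g : V * V -> V) (P : pred (V * V)) :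
    (forall e, P e -> h (g e) = e) -> (forall j, g (h j) = j) ->
    (forall j, P (h j)) ->
    \sum_(e in F) phi e * (P e)%:R = \sum_(j | h j \in F) phi (h j).
  move=> hg gh Ph.
  rewrite (eq_bigr (fun e => if P e then phi e else 0)); last first.
    by move=> e _; case: (P e); rewrite ?mulr1 ?mulr0.
  rewrite -big_mkcondr /= (reindex_onto h g) /=; last by move=> e /andP[_ /hg].
  by apply: eq_bigl => j; rewrite Ph gh eqxx !andbT.
rewrite /excess; under eq_bigr do rewrite /entry !inE mulrBr.
rewrite sumrB; congr (_ - _).
  apply: (reidx (fun j => (j, i)) fst) => // -[a c] /= /eqP -> //.
apply: (reidx (fun j => (i, j)) snd) => // -[a c] /= /eqP -> //.
Qed.

Lemma cutD1 u F e T : e \in F ->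
  cut u F T = (if crosses e T then u e else 0) + cut u (F :\ e) T.
Proof. by move=> eF; rewrite /cut !big_mkcondr /= (big_setD1 e). Qed.

(** In the sum over [T], only the crossing edges survive. *)
Lemma sum_excess_le_cut u phi F T :
  (forall e, e \in F -> - u e <= phi e <= u e) ->
  \sum_(i in T) excess phi F i <= cut u F T.
Proof.
move=> phi_u; rewrite sum_excess /cut big_mkcondr; apply: ler_sum => e /phi_u.
by rewrite /crosses /entry; case: (_ \in T); case: (_ \in T) => /= /andP[]; lra.
Qed.

(** Edge by edge: an edge crossing the intersection or the union crosses one of
    the two sets, and an edge crossing both crosses each of the two sets. *)
Lemma cut_submod u F T1 T2 : (forall e, e \in F -> 0 <= u e) ->
  cut u F (T1 :&: T2) + cut u F (T1 :|: T2) <= cut u F T1 + cut u F T2.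
Proof.
move=> u_ge0; rewrite /cut !big_mkcondr -!big_split /=.
apply: ler_sum => e /u_ge0; rewrite /crosses !inE.
by do 4!case: (_ \in _) => /=; lra.
Qed.

Lemma sum_setIU b T1 T2 :
  \sum_(i in T1 :&: T2) b i + \sum_(i in T1 :|: T2) b i =
  \sum_(i in T1) b i + \sum_(i in T2) b i.
Proof.
rewrite !(big_mkcond (fun i => i \in _)) -!big_split /=.
by apply: eq_bigr => i _; rewrite !inE; do 2!case: (_ \in _) => /=; lra.
Qed.

(** The largest of the lower bounds is such an [x]; starting the maximum at [a]
    covers the case where no [t] satisfies [P]. *)
Lemma separating_value (I : finType) (P Q : pred I) (f g : I -> R) (a c : R) :
  a <= c -> (forall t, P t -> f t <= c) -> (forall t, Q t -> a <= g t) ->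
  (forall t s, P t -> Q s -> f t <= g s) ->
  exists x, [/\ a <= x <= c, forall t, P t -> f t <= x
                           & forall t, Q t -> x <= g t].
Proof.
move=> ac fc ag fg; exists (\big[Num.max/a]_(t | P t) f t); split.
- by rewrite bigmax_ge_id; apply/bigmax_leP.
- by move=> t Pt; apply: le_bigmax_cond.
- by move=> s Qs; apply/bigmax_leP; split; [apply: ag | move=> t Pt; apply: fg].
Qed.

(** Putting the flow [x] on [e] lowers by [x] the demand of a set that [e]
    enters and raises by [x] the demand of a set that [e] leaves, so [x] has to
    lie above [- slack] on the former and below [slack] on the latter.
    Submodularity makes these bounds compatible. *)
Lemma cut_condition_D1 u b F e W : e \in F ->
    (forall e, e \in F -> 0 <= u e) ->
    (forall T, T \subset W -> \sum_(i in T) b i <= cut u F T) ->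
  exists2 x, - u e <= x <= u e & forall T, T \subset W ->
    \sum_(i in T) (b i - x * entry e [set i]) <= cut u (F :\ e) T.
Proof.
move=> eF u_ge0 bF; have ue := u_ge0 e eF.
pose enters T := [&& T \subset W, e.2 \in T & e.1 \notin T].
pose leaves T := [&& T \subset W, e.1 \in T & e.2 \notin T].
pose slack T := cut u (F :\ e) T - \sum_(i in T) b i.
have := @separating_value _ enters leaves (fun T => - slack T) slack
          (- u e) (u e).
case; first by lra.
- move=> T /and3P[/bF + e2 e1]; rewrite (cutD1 _ _ eF) /slack /crosses.
  by rewrite e2 (negbTE e1) /=; lra.
- move=> T /and3P[/bF + e1 e2]; rewrite (cutD1 _ _ eF) /slack /crosses.
  by rewrite e1 (negbTE e2) /=; lra.
- move=> T1 T2 /and3P[T1W e2T1 e1T1] /and3P[T2W e1T2 e2T2].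
  have T12W : T1 :&: T2 \subset W by apply: subset_trans (subsetIl _ _) T1W.
  have := bF _ T12W; have /bF : T1 :|: T2 \subset W by rewrite subUset T1W.
  (* The edge has one endpoint in each set, hence both in the union and none
     in the intersection: its capacity disappears from these two cuts. *)
  rewrite !(cutD1 _ _ eF) /crosses !inE e2T1 e1T2 (negbTE e1T1) (negbTE e2T2) /=.
  have := sum_setIU b T1 T2.
  have := cut_submod T1 T2 (fun d dF => u_ge0 d (subsetP (subD1set F e) d dF)).
  by rewrite /slack; lra.
move=> x [x_u low high]; exists x => // T TW.
rewrite sumrB -mulr_sumr sum_entry.
have := bF T TW; have := low T; have := high T.
rewrite (cutD1 _ _ eF) /enters /leaves /slack /crosses /entry TW /=.
case: (e.1 \in T); case: (e.2 \in T) => /=.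
- by move=> _ _; lra.
- by move=> /(_ isT) + _ _; lra.
- by move=> _ /(_ isT) + _; lra.
- by move=> _ _; lra.
Qed.

(** The supply-demand form of the max-flow min-cut theorem, with the vertices
    outside [W] as unlimited supplies. By induction on the number of edges: once
    none is left, the cut inequalities for singletons say that [b] is
    nonpositive on [W], so the zero flow works. *)
Theorem cut_condition_flow u b F W :
    (forall e, e \in F -> 0 <= u e) ->
    (forall T, T \subset W -> \sum_(i in T) b i <= cut u F T) ->
  exists phi, (forall e, e \in F -> - u e <= phi e <= u e) /\
              (forall i, i \in W -> b i <= excess phi F i).
Proof.
have [n] := ubnP #|F|; elim: n F b => // n IHn F b F_lt u_ge0 bF.
have [F0 | [e eF]] := set_0Vmem F.
  exists (fun=> 0); split=> [e|i iW]; first by rewrite F0 inE.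
  have := bF [set i]; rewrite sub1set => /(_ iW).
  by rewrite big_set1 /cut /excess F0 !big_pred0 // => e; rewrite inE.
have F'_lt : (#|F :\ e| < n)%N by move: F_lt; rewrite (cardsD1 e F) eF.
have F'F d : d \in F :\ e -> d \in F by case/setD1P.
have [x x_u bF'] := cut_condition_D1 eF u_ge0 bF.
have [phi [phi_u phi_b]] := IHn _ _ F'_lt (fun d dF => u_ge0 d (F'F d dF)) bF'.
exists (fun d => if d == e then x else phi d); split=> [d dF | i iW].
  by case: eqVneq => [-> // | de]; apply: phi_u; rewrite !inE de.
have := phi_b i iW; rewrite /excess (big_setD1 (A := F) e) //= eqxx.
rewrite lerBlDl; congr (_ <= _ + _); apply: eq_bigr => d.
by case/setD1P => /negbTE-> _.
Qed.

End Cuts.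

(** * The uniform pseudo-flow problem *)

Lemma cut_const (R : realDomainType) (V : finType) (E : {set V * V}) (c : R)
    (T : {set V}) :
  cut (fun=> c) E T = c * #|edge_boundary E T|%:R.
Proof.
rewrite /cut sumr_const mulr_natr; congr (_ *+ _); apply: eq_card => e.
by rewrite /crosses !inE unfold_in /=; do 3!case: (_ \in _).
Qed.

Lemma cheeger_attained (R : realType) (V : finType) (E : {set V * V})
    (U : scale V) (T0 : {set V}) :
    cheeger_admissible U T0 ->
  exists2 T, cheeger_admissible U T & cheeger R E U = cheeger_ratio R E T.
Proof.
move=> T0_adm; rewrite /cheeger; case: pickP => [T1 T1_adm|]; last first.
  by move/(_ T0); rewrite T0_adm.
by case: Order.TotalTheory.arg_minP => // T T_adm _; exists T.
Qed.

Lemma cheeger_le (R : realType) (V : finType) (E : {set V * V})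
    (U : scale V) (T : {set V}) :
  cheeger_admissible U T -> cheeger R E U <= cheeger_ratio R E T.
Proof.
move=> T_adm; rewrite /cheeger; case: pickP => [T1 T1_adm|]; last first.
  by move/(_ T); rewrite T_adm.
by case: Order.TotalTheory.arg_minP => // T2 _; apply.
Qed.

Lemma card_gt0R (R : realType) (V : finType) (T : {set V}) :
  T != set0 -> 0 < #|T|%:R :> R.
Proof. by rewrite ltr0n card_gt0. Qed.

Lemma uniform_feasible_le (R : realType) (V : finType) (E : {set V * V})
    (U : scale V) (eta : R) (phi : V * V -> V -> R) (T : {set V}) :
    uniform_feasible E U eta phi -> cheeger_admissible U T ->
  eta <= #|E|%:R^-1 * cheeger_ratio R E T.
Proof.
case=> phi_E eta_le /andP[T_neq0 /existsP[k /subsetP TU]].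
rewrite /cheeger_ratio mulrA ler_pdivlMr ?card_gt0R // -cut_const.
apply: le_trans (sum_excess_le_cut (phi := phi^~ k) _ _); last first.
  by move=> e eE; rewrite -div1r; apply: phi_E.
rewrite mulr_natr -sumr_const; apply: ler_sum => i /TU iU.
by rewrite excessE; apply: eta_le.
Qed.

(** For the constant demand [cheeger / |E|] and the constant capacity [1 / |E|],
    the cut inequality of [T] is the definition of the Cheeger constant as a
    lower bound of the ratios; the flows for the various [k] are chosen
    independently. *)
Lemma uniform_feasible_cheeger (R : realType) (V : finType) (E : {set V * V})
    (U : scale V) :
  exists phi, uniform_feasible E U (#|E|%:R^-1 * cheeger R E U) phi.
Proof.
pose c : R := #|E|%:R^-1; have c_ge0 : 0 <= c by rewrite invr_ge0.
have flow k : exists psi : V * V -> R,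
    (forall e, e \in E -> - c <= psi e <= c) /\
    (forall i, i \in U k -> c * cheeger R E U <= excess psi E i).
  apply: (cut_condition_flow (u := fun=> c)) => // T TU.
  rewrite sumr_const cut_const -[leLHS]mulr_natr -mulrA ler_wpM2l //.
  have [-> | T_neq0] := eqVneq T set0; first by rewrite cards0 mulr0.
  rewrite -ler_pdivlMr ?card_gt0R //; apply: cheeger_le.
  by rewrite /cheeger_admissible T_neq0; apply/existsP; exists k.
have [psi psiP] := fin_all_exists flow; exists (fun e k => psi k e).
split=> [e k eE | k i iU]; first by rewrite div1r; apply: (psiP k).1.
by rewrite -excessE; apply: (psiP k).2.
Qed.

Theorem theorem7p2 (R : realType) (V : finType) (E : {set V * V})
    (S : scale V) (E_loopless : no_self_loops E) (E_neq0 : E != set0)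
    (S_nonempty : exists i : V, S i != set0) :
  uniform_optimal_value E (dual_scale S)
    (#|V|%:R / #|E|%:R * cheeger R E (dual_scale S)).
Proof.
rewrite -mulrA; split.
  have [phi phi_feas] := uniform_feasible_cheeger R E (dual_scale S).
  by exists (#|E|%:R^-1 * cheeger R E (dual_scale S)), phi.
move=> eta phi phi_feas; apply: ler_wpM2l => //.
have [i /set0Pn[j jSi]] := S_nonempty.
have : cheeger_admissible (dual_scale S) [set i].
  rewrite /cheeger_admissible -card_gt0 cards1; apply/existsP; exists j.
  by rewrite sub1set inE.
case/(cheeger_attained R E) => T T_adm ->.
exact: uniform_feasible_le phi_feas T_adm.
Qed.
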